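(* Let $\mathcal{C}$ be a closed convex set of distributions of $CZ$. Then for $\beta>0$ the family of inequalities on a real-valued function $F$ of $CZ$ given by $$F\ge0,\qquad \mathbb{E}_\nu\bigl(F(CZ)\,\nu(C|Z)^\beta\bigr)\le1\ \text{ for all }\nu\in\mathcal{C}$$ is implied by the subset of these inequalities consisting of $F\ge 0$ and those with $\nu\in\mathrm{Extr}(\mathcal{C})$.
   Context: $C$ and $Z$ are random variables with finite value spaces. $\mathrm{Extr}(\mathcal{C})$ is the set of extreme points of $\mathcal{C}$. $\nu(C|Z)$ denotes the random variable whose value at $cz$ is the conditional probability $\nu(c|z)$. Expectations are sums over values of positive probability only. *)

(* Defs.v *)
From mathcomp Require Export all_boot all_order all_algebra.
From mathcomp Require Export all_classical all_reals all_analysis.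

Set Implicit Arguments.
Unset Strict Implicit.
Unset Printing Implicit Defensive.

Import Order.TTheory GRing.Theory Num.Theory.
Import numFieldNormedType.Exports.

Local Open Scope classical_set_scope.
Local Open Scope ring_scope.
Local Open Scope convex_scope.

Definition extreme_points (R : numDomainType) (M : lmodType R)
    (A : set (convex_lmodType M)) : set (convex_lmodType M) :=
  [set x | A x /\
    forall (y z : convex_lmodType M) (t : {i01 R}),
      A y -> A z -> 0 < t%:num < 1 -> x = y <| t |> z -> y = x /\ z = x].

Definition is_distribution (R : realType) (T : finType) (nu : T -> R^o) :=
  (forall x, 0 <= nu x) /\ \sum_x nu x = 1.

(* Closedness is with respect to the topology of pointwise convergence, that
   is, the usual topology of the finite-dimensional space [T -> R]. *)
Definition closed_pointwise (R : realType) (T : finType) (A : set (T -> R^o)) :=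
  closed (A : set {ptws T -> R^o}).

Definition marginalZ (R : realType) (C Z : finType) (nu : C * Z -> R^o) (z : Z)
    : R :=
  \sum_c nu (c, z).

(* The value is meaningful only where [marginalZ nu cz.2] is nonzero. *)
Definition condprob (R : realType) (C Z : finType) (nu : C * Z -> R^o)
    (cz : C * Z) : R :=
  nu cz / marginalZ nu cz.2.

Definition expect (R : realType) (T : finType) (nu : T -> R^o) (G : T -> R)
    : R :=
  \sum_(x | 0 < nu x) nu x * G x.

Definition pef_inequalities (R : realType) (C Z : finType) (beta : R)
    (A : set (C * Z -> R^o)) (F : C * Z -> R) :=
  (forall cz, 0 <= F cz) /\
  forall nu, A nu -> expect nu (fun cz => F cz * (condprob nu cz) `^ beta) <= 1.

(* Main.v *)
(* The expectation is [Phi nu = \sum F(cz) persp(nu(cz), nu(z))], where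
   [persp x y = x (x / y)^beta] is [y] times the convex function [u^(1 + beta)]
   of [u = x / y]. Hence [persp] is sublinear on [0 <= x <= y], and [Phi] is
   convex; it is also continuous there, because [0 <= persp x y <= x] takes care
   of the points with [x = 0]. Instead of decomposing [nu] into extreme points,
   maximize [Phi + d |.|^2] for a small [d > 0] over the compact set [A]: strict
   convexity makes every maximizer an extreme point, and [d] tends to 0. *)
Require Import Defs.
From mathcomp Require Import ring lra.
Import Order.TTheory GRing.Theory Num.Theory.
Import numFieldNormedType.Exports.
Local Open Scope classical_set_scope.
Local Open Scope ring_scope.

Definition persp {R : realType} (b x y : R) : R := x * (x / y) `^ b.

Lemma persp_ge0 {R : realType} (b x y : R) : 0 <= x -> 0 <= persp b x y.
Proof. by move=> x0; rewrite mulr_ge0 ?powR_ge0. Qed.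

Lemma persp0 {R : realType} (b y : R) : persp b 0 y = 0.
Proof. by rewrite /persp mul0r. Qed.

Lemma persp_le {R : realType} (b x y : R) :
  0 < b -> 0 <= x <= y -> persp b x y <= x.
Proof.
move=> b0 /andP[x0 xy]; have y0 := le_trans x0 xy.
have xy1 : x / y <= 1.
  have [->|yN0] := eqVneq y 0; first by rewrite invr0 mulr0.
  by rewrite ler_pdivrMr ?mul1r// lt_def yN0.
rewrite ler_piMr//; have := @ge0_ler_powR R b (ltW b0) (x / y) 1.
by rewrite powR1 !nnegrE divr_ge0//; apply.
Qed.

Lemma persp_homogeneous {R : realType} (b s x y : R) :
  s != 0 -> persp b (s * x) (s * y) = s * persp b x y.
Proof. by move=> s0; rewrite /persp -mulf_div divff// mul1r mulrA. Qed.

Lemma perspE {R : realType} (b x y : R) : 0 < b -> 0 <= x -> 0 < y ->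
  persp b x y = y * (x / y) `^ (b + 1).
Proof.
move=> b0 x0 y0.
have u0 : 0 <= x / y by rewrite divr_ge0// ltW.
by rewrite -(mulr_powRB1 u0) ?addr_gt0// addrK mulrA [y * _]mulrC divfK ?gt_eqF.
Qed.

(* With [l = y1 / (y1 + y2)], the ratio [(x1 + x2) / (y1 + y2)] is the
   [l]-convex combination of the ratios [x1 / y1] and [x2 / y2]. *)
Lemma persp_subadditive {R : realType} (b x1 y1 x2 y2 : R) : 0 < b ->
  0 <= x1 <= y1 -> 0 <= x2 <= y2 ->
  persp b (x1 + x2) (y1 + y2) <= persp b x1 y1 + persp b x2 y2.
Proof.
move=> b0 /andP[x10 xy1] /andP[x20 xy2].
(* [perspE] needs positive denominators. A zero denominator forces its numerator to be zero, so that
   pair contributes nothing to either side. *)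
have [y1E|y1N0] := eqVneq y1 0.
  have -> : x1 = 0 by apply/le_anti; rewrite x10 -y1E xy1.
  by rewrite y1E !add0r persp0 add0r.
have [y2E|y2N0] := eqVneq y2 0.
  have -> : x2 = 0 by apply/le_anti; rewrite x20 -y2E xy2.
  by rewrite y2E !addr0 persp0 addr0.
have y10 : 0 < y1 by rewrite lt_def y1N0 (le_trans x10).
have y20 : 0 < y2 by rewrite lt_def y2N0 (le_trans x20).
have y0 : 0 < y1 + y2 by rewrite addr_gt0.
have l0 : 0 <= y1 / (y1 + y2) by rewrite divr_ge0 ?ltW.
have l1 : y1 / (y1 + y2) <= 1 by rewrite ler_pdivrMr// mul1r lerDl ltW.
rewrite !perspE ?addr_ge0//.
have b1 : 1 <= b + 1 by rewrite lerDr ltW.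
pose l := y1 / (y1 + y2).
have : (l * (x1 / y1) + (1 - l) * (x2 / y2)) `^ (b + 1) <=
    l * (x1 / y1) `^ (b + 1) + (1 - l) * (x2 / y2) `^ (b + 1).
  apply: (@convex_powR R _ b1 (Itv01 l0 l1) (x1 / y1) (x2 / y2));
  by rewrite inE/= in_itv/= andbT divr_ge0// ltW.
have -> : 1 - l = y2 / (y1 + y2) by rewrite /l; field; rewrite gt_eqF.
rewrite /l.
have -> : y1 / (y1 + y2) * (x1 / y1) + y2 / (y1 + y2) * (x2 / y2) =
  (x1 + x2) / (y1 + y2) by field; rewrite !gt_eqF.
move=> h; rewrite -(ler_pM2l y0) in h; apply: (le_trans h).
have yK z : (y1 + y2) * (z / (y1 + y2)) = z by rewrite mulrC divfK ?gt_eqF.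
by rewrite mulrDr ![(y1 + y2) * (_ / _ * _)]mulrA !yK.
Qed.

(** Homogeneity absorbs the weights [t] and [1 - t] into the arguments, which leaves
    subadditivity. *)
Lemma persp_convex {R : realType} (b t x1 y1 x2 y2 : R) : 0 < b -> 0 < t < 1 ->
  0 <= x1 <= y1 -> 0 <= x2 <= y2 ->
  persp b (t * x1 + (1 - t) * x2) (t * y1 + (1 - t) * y2) <=
  t * persp b x1 y1 + (1 - t) * persp b x2 y2.
Proof.
move=> b0 /andP[t0 t1] /andP[x10 xy1] /andP[x20 xy2].
have s0 : 0 < 1 - t by rewrite subr_gt0.
rewrite -!persp_homogeneous ?gt_eqF//.
by apply: persp_subadditive => //; rewrite mulr_ge0 ?ler_pM2l // ltW.
Qed.

Lemma cvg_sumr {R : realType} {T : Type} {I : finType} (F : set_system T)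
    {FF : Filter F} (f : I -> T -> R) (a : I -> R) :
  (forall i, f i @ F --> a i) ->
  (fun t => \sum_i f i t) @ F --> \sum_i a i.
Proof.
by move=> fa; apply: cvg_big => // z; exact: add_continuous.
Qed.

(** If [x = 0], the ratio [f t / g t] may have no limit, but [persp] is squeezed between 0 and
    [f t]. If [x > 0], then [y > 0] too, and the power is continuous at [x / y > 0]. *)
Lemma cvg_persp {R : realType} {T : Type} (F : set_system T) {FF : Filter F}
    (f g : T -> R) (b x y : R) : 0 < b ->
  (\forall t \near F, 0 <= f t <= g t) -> 0 <= x <= y ->
  f @ F --> x -> g @ F --> y ->
  (fun t => persp b (f t) (g t)) @ F --> persp b x y.
Proof.
move=> b0 fg /andP[x0 xy] fx gy.
have [xE|xN0] := eqVneq x 0.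
  rewrite xE persp0; apply: (@squeeze_cvgr _ _ _ _ (cst 0) f).
  - apply: filterS fg => t /[dup] /andP[f0 _] ?.
    by rewrite persp_ge0//= persp_le.
  - exact: cvg_cst.
  - by rewrite xE in fx.
have xpos : 0 < x by rewrite lt_def xN0.
have ypos : 0 < y := lt_le_trans xpos xy.
apply: cvgM => //.
apply: (@continuous_cvg _ _ _ F _ (fun t => f t / g t) (fun u : R => u `^ b)).
  apply: differentiable_continuous; apply/derivable1_diffP.
  by apply: derivable_powR; rewrite in_itv/= andbT divr_gt0.
by apply: cvgM => //; apply: cvgV => //; rewrite gt_eqF.
Qed.

Definition sum_sq {R : realType} {T : finType} (f : T -> R^o) : R :=
  \sum_i f i ^+ 2.

Lemma cvg_eval {R : realType} {T : finType} (A : set (T -> R^o)) f i :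
  (fun g : T -> R^o => g i : R) @ within A (nbhs (f : {ptws T -> R^o})) --> f i.
Proof.
apply: cvg_trans (@proj_continuous T (fun=> R^o) i f).
apply: cvg_app.
exact: (@cvg_within _ (nbhs (f : {ptws T -> R^o})) _ A).
Qed.

Lemma bauer_maximum_principle {R : realType} {T : finType} (A : set (T -> R^o))
    (Phi : (T -> R^o) -> R) (m : R) :
  compact (A : set {ptws T -> R^o}) ->
  {within (A : set {ptws T -> R^o}), continuous (Phi : {ptws T -> R^o} -> R)} ->
  (forall (y z : convex_lmodType (T -> R^o)) (t : {i01 R}), A y -> A z ->
     0 < t%:num < 1 ->
     Phi (conv t y z) <= t%:num * Phi y + (1 - t%:num) * Phi z) ->
  (forall x, extreme_points A x -> Phi x <= m) ->
  forall x, A x -> Phi x <= m.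
Proof.
move=> Ac Phic Phiconv extm x Ax.
have A0 : (A : set {ptws T -> R^o}) !=set0 by exists x.
have sqc : {within (A : set {ptws T -> R^o}),
    continuous (sum_sq : {ptws T -> R^o} -> R)}.
  apply/subspace_continuousP => f Af.
  by apply: cvg_sumr => i; apply: cvgM; exact: cvg_eval.
(* The maximum of [sum_sq] on [A] bounds the perturbation at every point of [A], whatever [d] is. *)
have [c _ cmax] := compact_EVT_max A0 Ac sqc.
apply/ler_addgt0Pr => e e0.
(* This makes [d * sum_sq] at most [e] on [A]; the [+ 1] keeps the denominator positive when
   [sum_sq c = 0]. *)
pose d := e / (sum_sq c + 1).
have sq0 (f : T -> R^o) : 0 <= sum_sq f by apply: sumr_ge0 => i _; exact: sqr_ge0.
have d0 : 0 < d by rewrite divr_gt0// ltr_wpDl.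
have Psic : {within (A : set {ptws T -> R^o}),
    continuous ((fun f => Phi f + d * sum_sq f) : {ptws T -> R^o} -> R)}.
  move=> f; apply: cvgD; first exact: Phic.
  by apply: cvgM; [exact: cvg_cst|exact: sqc].
have [p pA pmax] := compact_EVT_max A0 Ac Psic.
have pext : extreme_points A p.
  split; first by rewrite inE in pA.
  move=> y z t Ay Az t01 pE.
  have my := pmax y (mem_set Ay); have mz := pmax z (mem_set Az).
  have Phip := Phiconv y z t Ay Az t01; rewrite -pE in Phip.
  (* The last term is the exact gap in the convexity of the square; it makes the perturbed function
     strictly convex. *)
  have sqr_conv (s u v : R) : (s * u + (1 - s) * v) ^+ 2 =
      s * u ^+ 2 + (1 - s) * v ^+ 2 - s * (1 - s) * (u - v) ^+ 2 by ring.
  have sqp : sum_sq p = t%:num * sum_sq y + (1 - t%:num) * sum_sq z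
      - t%:num * (1 - t%:num) * sum_sq (y - z).
    rewrite pE /sum_sq !mulr_sumr -big_split/= -sumrB; apply: eq_bigr => i _.
    exact: sqr_conv.
  case/andP: t01 => t0 t1.
  (* Weighting the maximality of [p] against [y] and [z] by [t] and [1 - t], and using convexity of
     [Phi], leaves [d * t * (1 - t) * sum_sq (y - z) <= 0]. *)
  have yz0 : sum_sq (y - z) = 0.
    apply/le_anti; rewrite sq0 andbT.
    have s0 : 0 < 1 - t%:num by rewrite subr_gt0.
    rewrite -(pmulr_rle0 _ (mulr_gt0 d0 (mulr_gt0 t0 s0))).
    rewrite -(ler_pM2l t0) in my; rewrite -(ler_pM2l s0) in mz.
    rewrite sqp in my mz.
    lra.
  have yz : y = z.
    apply/funext => i; apply/eqP; rewrite -subr_eq0 -sqrf_eq0; apply/eqP.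
    by apply: (psumr_eq0P _ yz0) => // j _; exact: sqr_ge0.
  by rewrite pE -yz convmm.
(* [Phi x <= Phi p + d * sum_sq p <= m + d * sum_sq c <= m + e]. *)
have := pmax x (mem_set Ax); have := extm p pext.
have := cmax p pA; have := sq0 x.
have ed : d * (sum_sq c + 1) = e by rewrite divfK// gt_eqF// ltr_wpDl.
move=> h1 h2 h3 h4.
have h5 : d * sum_sq p <= d * sum_sq c by rewrite ler_pM2l.
have h6 : 0 <= d * sum_sq x by rewrite mulr_ge0// ltW.
lra.
Qed.

(** Probabilities lie in [[0, 1]], so [A] is a closed subset of a cube, which is compact by
    Tychonoff. *)
Lemma compact_distributions {R : realType} {T : finType} (A : set (T -> R^o)) :
  A `<=` @is_distribution R T -> closed_pointwise A ->
  compact (A : set {ptws T -> R^o}).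
Proof.
move=> Ad Ac.
have K : compact [set f : {ptws T -> R^o} | forall i, `[0, 1]%classic (f i)].
  by apply: (@tychonoff T (fun=> R^o) (fun=> `[0, 1]%classic)) => _;
    exact: segment_compact.
apply: (subclosed_compact Ac K) => f /Ad[f0 f1] i /=.
rewrite in_itv/= f0/= -f1 (bigD1 i)//= lerDl.
by apply: sumr_ge0.
Qed.

Lemma le_marginalZ {R : realType} {C Z : finType} (nu : C * Z -> R^o) cz :
  (forall cz, 0 <= nu cz) -> 0 <= nu cz <= marginalZ nu cz.2.
Proof.
move=> nu0; rewrite nu0 /marginalZ (bigD1 cz.1)//= -surjective_pairing.
by rewrite lerDl sumr_ge0.
Qed.

(** Terms of probability zero vanish because [persp b 0 y = 0], so the range of summation no longer
    depends on [nu]. *)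
Lemma expect_persp {R : realType} {C Z : finType} (b : R) (F : C * Z -> R)
    (nu : C * Z -> R^o) : (forall cz, 0 <= nu cz) ->
  expect nu (fun cz => F cz * (condprob nu cz) `^ b) =
  \sum_cz F cz * persp b (nu cz) (marginalZ nu cz.2).
Proof.
move=> nu0; rewrite /expect big_mkcond/=; apply: eq_bigr => cz _.
case: ifPn => [_|]; first by rewrite /persp mulrCA.
by rewrite lt_def nu0 andbT negbK => /eqP ->; rewrite persp0 mulr0.
Qed.

Theorem theorem28 (R : realType) (C Z : finType) (A : set (C * Z -> R^o))
    (A_distr : A `<=` @is_distribution R (C * Z)%type)
    (A_closed : closed_pointwise A)
    (A_convex : convex_set A)
    (beta : R) (beta_gt0 : 0 < beta) (F : C * Z -> R) :
  pef_inequalities beta (extreme_points A) F -> pef_inequalities beta A F.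
Proof.
move=> [F0 ext]; split=> // nu Anu.
have A0 f : A f -> forall cz, 0 <= f cz by move=> /A_distr[].
pose Phi (f : C * Z -> R^o) :=
  \sum_cz F cz * persp beta (f cz) (marginalZ f cz.2).
rewrite (expect_persp _ _ _ (A0 _ Anu)) -/(Phi nu).
apply: (@bauer_maximum_principle R _ A Phi 1 _ _ _ _ nu Anu).
- exact: compact_distributions.
- apply/subspace_continuousP => f Af.
  apply: cvg_sumr => cz; apply: cvgM; first exact: cvg_cst.
  apply: cvg_persp => //.
  + by rewrite near_withinE; apply: nearW => g /A0 g0; exact: le_marginalZ.
  + exact: le_marginalZ (A0 _ Af).
  + exact: cvg_eval.
  + by rewrite /marginalZ; apply: cvg_sumr => c; exact: cvg_eval.
- move=> y z t Ay Az t01.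
  rewrite /Phi !mulr_sumr -big_split/=; apply: ler_sum => cz _.
  rewrite !(mulrCA _ (F cz)) -mulrDr ler_wpM2l//.
  (* Marginals are linear in the distribution, so both arguments of [persp] mix with the same
     weights. *)
  have -> : marginalZ (conv t y z) cz.2 =
     t%:num * marginalZ y cz.2 + (1 - t%:num) * marginalZ z cz.2.
    by rewrite /marginalZ !mulr_sumr -big_split.
  apply: persp_convex => //; apply: le_marginalZ; exact: A0.
- move=> p pext; rewrite /Phi -expect_persp; first exact: ext.
  by apply: A0; case: pext.
Qed.
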